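(* For $q=1,\dots,N$ define $\theta^{\{q\}}(\mathfrak t)\in\mathbb R^{s^{\{q\}}}$ for $\mathfrak t\in\mathbb{TW}_N$ recursively by: $\theta^{\{q\}}(\emptyset)=0$; $\theta^{\{q\}}(\tau_{\bigcirc q})=\mathbf 1^{\{q\}}$; $\theta^{\{q\}}([\mathfrak t_1,\dots,\mathfrak t_L]_{\bigcirc q})=\times_{\ell=1}^L\big(\sum_{m=1}^N\alpha^{\{q,m\}}\theta^{\{m\}}(\mathfrak t_\ell)\big)$ for $L\ge1$; $\theta^{\{q\}}([\mathfrak t_1]_{\square q})=\sum_{m=1}^N\gamma^{\{q,m\}}\theta^{\{m\}}(\mathfrak t_1)$; and $\theta^{\{q\}}(\mathfrak t)=0$ if the root of $\mathfrak t$ has color different from $q$. Let $\phi(\mathfrak t)=\sum_{m=1}^N b^{\{m\}T}\theta^{\{m\}}(\mathfrak t)$. Then the GARK-ROW method has order $p$ for arbitrary matrices $\mathbf L^{\{1\}},\dots,\mathbf L^{\{N\}}$ if and only if, for all $\mathfrak t\in\mathbb{TW}_N$ with $1\le\rho(\mathfrak t)\le p$, $$\phi(\mathfrak t)=\frac1{\gamma(\mathfrak t)}\ \text{ if }\mathfrak t\in\mathbb T_N,\qquad \phi(\mathfrak t)=0\ \text{ if }\mathfrak t\in\mathbb{TW}_N\setminus\mathbb T_N.$$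
   Context: Problem: $\mathbf y'=\sum_{m=1}^N\mathbf f^{\{m\}}(\mathbf y)$, $\mathbf y\in\mathbb R^d$, smooth $\mathbf f^{\{m\}}$. GARK-ROW method: for each $q$ stages $s^{\{q\}}$, weights $b^{\{q\}}\in\mathbb R^{s^{\{q\}}}$, matrices $\alpha^{\{q,m\}},\gamma^{\{q,m\}}\in\mathbb R^{s^{\{q\}}\times s^{\{m\}}}$ with $\alpha^{\{q,m\}}_{i,j}=0$ for $j\ge i$, $\gamma^{\{q,m\}}_{i,j}=0$ for $j>i$. One step: $k_i^{\{q\}}=h\,\mathbf f^{\{q\}}\big(\mathbf y_n+\sum_{m}\sum_{j<i}\alpha^{\{q,m\}}_{i,j}k_j^{\{m\}}\big)+h\,\mathbf L^{\{q\}}\sum_{m}\sum_{j\le i}\gamma^{\{q,m\}}_{i,j}k_j^{\{m\}}$, $\mathbf y_{n+1}=\mathbf y_n+\sum_q\sum_ib^{\{q\}}_ik_i^{\{q\}}$, where $\mathbf L^{\{q\}}\in\mathbb R^{d\times d}$ are arbitrary (solution-independent) matrices. Order $p$: local error $O(h^{p+1})$. $\mathbf 1^{\{q\}}$ is the vector of ones in $\mathbb R^{s^{\{q\}}}$; $\times$ is componentwise product. Trees: $\mathbb{TW}_N$ is the set of rooted trees (including empty tree $\emptyset$) whose vertices are round ($\bigcirc$) or square ($\square$), each colored with one of $1,\dots,N$; square vertices have exactly one child (no square leaves). $\mathbb T_N\subset\mathbb{TW}_N$ consists of trees with only round vertices. $\tau_{\bigcirc m}$: single round vertex of color $m$; $[\mathfrak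 t_1,\dots,\mathfrak t_L]_{\bigcirc m}$: nonempty $\mathfrak t_i$ attached to a new round root of color $m$; $[\mathfrak t_1]_{\square m}$: nonempty $\mathfrak t_1$ attached to a new square root of color $m$. $\rho$: number of vertices. Density (distinct from the matrices $\gamma^{\{q,m\}}$): $\gamma(\emptyset)=\gamma(\tau_{\bigcirc m})=1$, $\gamma([\mathfrak t_1,\dots,\mathfrak t_L]_{\bigcirc m})=\rho(\mathfrak t)\prod_\ell\gamma(\mathfrak t_\ell)$, $\gamma([\mathfrak t_1]_{\square m})=\rho(\mathfrak t)\gamma(\mathfrak t_1)$. *)

(* Defs.v *)
From HB Require Import structures.
From mathcomp Require Import all_boot all_order all_algebra.
From mathcomp Require Import all_classical all_reals all_analysis.
Set Implicit Arguments. Unset Strict Implicit. Unset Printing Implicit Defensive.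
Import Order.TTheory GRing.Theory Num.Theory.
Import numFieldNormedType.Exports.
Local Open Scope ring_scope.

(* Children of a round vertex are stored as a list (planar representative of
   the unordered tree); every quantity below is invariant under reordering
   of children. Colors are 'I_N (color c+1 in the paper = c here). *)
Inductive tw (N : nat) : Type :=
| Round  : 'I_N -> seq (tw N) -> tw N   (* [t_1,...,t_L]_{round c}; L=0 is tau_{round c} *)
| Square : 'I_N -> tw N -> tw N.

Section Trees.
Variable N : nat.

Fixpoint rho (t : tw N) : nat :=
  match t with
  | Round _ ch => (sumn (map rho ch)).+1
  | Square _ u => (rho u).+1
  end.

(* density gamma (tree density, not the matrices gamma^{q,m}) *)
Fixpoint density (t : tw N) : nat :=
  match t with
  | Round _ ch => rho t * foldr muln 1%N (map density ch)
  | Square _ u => rho t * density u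
  end.

Fixpoint only_round (t : tw N) : bool :=
  match t with
  | Round _ ch => all only_round ch
  | Square _ _ => false
  end.
End Trees.

Section Weights.
Variables (R : realType) (N : nat) (s : 'I_N -> nat).
Variable alpha : forall q m : 'I_N, 'M[R]_(s q, s m).
Variable gamma : forall q m : 'I_N, 'M[R]_(s q, s m).
Variable b : forall q : 'I_N, 'cV[R]_(s q).

Fixpoint theta (t : tw N) (q : 'I_N) {struct t} : 'cV[R]_(s q) :=
  match t with
  | Round c ch =>
      if c == q then
        (fix prodc (l : seq (tw N)) : 'cV[R]_(s q) :=
           match l with
           | [::] => const_mx 1
           | u :: l' => \col_i ((\sum_(m < N) alpha q m *m theta u m) i ord0
                                 * prodc l' i ord0)
           end) ch
      else 0
  | Square c u =>
      if c == q then \sum_(m < N) gamma q m *m theta u m else 0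
  end.

Definition phi (t : tw N) : R :=
  \sum_(m < N) ((b m)^T *m theta t m) ord0 ord0.
End Weights.

Section Method.
Variables (R : realType) (N : nat) (s : 'I_N -> nat).
Variable alpha : forall q m : 'I_N, 'M[R]_(s q, s m).
Variable gamma : forall q m : 'I_N, 'M[R]_(s q, s m).
Variable b : forall q : 'I_N, 'cV[R]_(s q).

Fixpoint Ck (d e : nat) (k : nat) (f : 'cV[R]_d -> 'cV[R]_e) : Prop :=
  match k with
  | O => continuous f
  | S k' => (forall x, differentiable f x) /\
            (forall v : 'cV[R]_d, Ck k' (fun x => 'D_v f x))
  end.
Definition smooth (d e : nat) (f : 'cV[R]_d -> 'cV[R]_e) : Prop :=
  forall k, Ck k f.

Definition gark_row_stages (d : nat) (f : 'I_N -> 'cV[R]_d -> 'cV[R]_d)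
    (L : 'I_N -> 'M[R]_d) (y0 : 'cV[R]_d) (h : R)
    (k : forall q : 'I_N, 'I_(s q) -> 'cV[R]_d) : Prop :=
  forall (q : 'I_N) (i : 'I_(s q)),
    k q i =
      h *: f q (y0 + \sum_(m < N) \sum_(j < s m | (j < i)%N) alpha q m i j *: k m j)
    + h *: (L q *m \sum_(m < N) \sum_(j < s m | (j <= i)%N) gamma q m i j *: k m j).

Definition gark_row_output (d : nat) (y0 : 'cV[R]_d)
    (k : forall q : 'I_N, 'I_(s q) -> 'cV[R]_d) : 'cV[R]_d :=
  y0 + \sum_(q < N) \sum_(i < s q) b q i ord0 *: k q i.

Definition exact_solution (d : nat) (f : 'I_N -> 'cV[R]_d -> 'cV[R]_d)
    (y0 : 'cV[R]_d) (y : R -> 'cV[R]_d) : Prop :=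
  y 0 = y0 /\
  \forall t \near (0 : R), is_derive (t : R) (1 : R) y (\sum_(m < N) f m (y t)).

Definition gark_row_order (p : nat) : Prop :=
  forall (d : nat) (f : 'I_N -> 'cV[R]_d -> 'cV[R]_d) (L : 'I_N -> 'M[R]_d)
         (y0 : 'cV[R]_d) (K : R -> forall q : 'I_N, 'I_(s q) -> 'cV[R]_d)
         (y : R -> 'cV[R]_d),
    (forall m, smooth (f m)) ->
    (\forall h \near (0 : R), gark_row_stages f L y0 h (K h)) ->
    exact_solution f y0 y ->
    (fun h : R => gark_row_output y0 (K h) - y h)
      =O_ (0 : R) (fun h : R => h ^+ p.+1).
End Method.

(* Main.v *)
Require Import Defs.
From HB Require Import structures.
From mathcomp Require Import all_boot all_order all_algebra.
From mathcomp Require Import all_classical all_reals all_analysis.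
From mathcomp Require Import ring lra.
Set Implicit Arguments. Unset Strict Implicit. Unset Printing Implicit Defensive.
Import Order.TTheory GRing.Theory Num.Theory.
Import numFieldNormedType.Exports.
Local Open Scope classical_set_scope.
Local Open Scope ring_scope.

(** Sufficiency. Expanding the smooth fields at [y0] in monomials and multiplying
    out, induction on the order yields one finite list of pairs (tree, vector) such
    that the stages are sums of [h ^ rho t * theta t * v] and the exact solution is
    [y0] plus the sum of [h ^ rho t / density t * v] over round trees, both up to the
    same power of [h]. Since trees are planar, no symmetry coefficients occur, and
    the order conditions make the two expansions agree.

    Necessity. For a tree [t], the system with one coordinate per subtree of [t] in
    which a round vertex multiplies the coordinates of its children, and a square
    vertex copies its child through [L], is solved in closed form by both the method
    and the flow; the coordinate of [t] has error [h ^ rho t] times the defect of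
    the order condition of [t]. *)

(** * Big-O calculus for scalar functions near zero *)

Section PowerDomination.
Variable R : realType.
Implicit Types (u v : R -> R) (n : nat).

(** The neighbourhood contains [h = 0], so for positive [n] the bound also forces [u 0 = 0]. *)
Definition Oh n u : Prop :=
  exists C : R, \forall h \near (0 : R), `|u h| <= C * `|h| ^+ n.

Lemma Oh_pos n u : Oh n u ->
  exists2 C : R, 0 <= C & \forall h \near (0 : R), `|u h| <= C * `|h| ^+ n.
Proof.
case=> C HC; exists `|C| => //; apply: filterS HC => h /le_trans; apply.
by rewrite ler_wpM2r ?exprn_ge0 ?ler_norm.
Qed.

Lemma Oh_near n u v :
  (\forall h \near (0 : R), u h = v h) -> Oh n u -> Oh n v.
Proof.
move=> uv [C HC]; exists C; move: uv HC; apply: filterS2 => h -> //.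
Qed.

Lemma Oh_eq n u v : (forall h, u h = v h) -> Oh n u -> Oh n v.
Proof. by move=> uv; apply: Oh_near; apply: filterE. Qed.

Lemma Oh0 n : Oh n (fun=> 0).
Proof. by exists 0; apply: filterE => h; rewrite normr0 mul0r. Qed.

Lemma OhD n u v : Oh n u -> Oh n v -> Oh n (fun h => u h + v h).
Proof.
move=> [C HC] [D HD]; exists (C + D); move: HC HD; apply: filterS2 => h uC vD.
by rewrite mulrDl (le_trans (ler_normD _ _)) ?lerD.
Qed.

Lemma OhN n u : Oh n u -> Oh n (fun h => - u h).
Proof. by move=> [C HC]; exists C; apply: filterS HC => h; rewrite normrN. Qed.

Lemma OhB n u v : Oh n u -> Oh n v -> Oh n (fun h => u h - v h).
Proof. by move=> Ou Ov; apply: OhD Ou (OhN Ov). Qed.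

Lemma OhM m n u v : Oh m u -> Oh n v -> Oh (m + n) (fun h => u h * v h).
Proof.
move=> /Oh_pos[C C0 HC] /Oh_pos[D D0 HD]; exists (C * D).
move: HC HD; apply: filterS2 => h uC vD.
by rewrite normrM exprD mulrACA ler_pM.
Qed.

Lemma Oh_cst c : Oh 0 (fun=> c).
Proof. by exists `|c|; apply: filterE => h; rewrite expr0 mulr1. Qed.

Lemma Oh_id : Oh 1 id.
Proof. by exists 1; apply: filterE => h; rewrite expr1 mul1r. Qed.

Lemma OhMl n c u : Oh n u -> Oh n (fun h => c * u h).
Proof. exact: OhM (Oh_cst c). Qed.

Lemma OhMr n c u : Oh n u -> Oh n (fun h => u h * c).
Proof. by move=> /(OhMl c); apply: Oh_eq => h; rewrite mulrC. Qed.

Lemma Oh_sum n I (r : seq I) (P : pred I) (F : I -> R -> R) :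
  (forall i, P i -> Oh n (F i)) -> Oh n (fun h => \sum_(i <- r | P i) F i h).
Proof.
move=> HF; elim: r => [|i r IH].
  by apply: Oh_eq (Oh0 n) => h; rewrite big_nil.
have [Pi|Pi] := boolP (P i).
  by apply: Oh_eq (OhD (HF i Pi) IH) => h; rewrite big_cons Pi.
by apply: Oh_eq IH => h; rewrite big_cons (negbTE Pi).
Qed.

Lemma Oh_le m n u : (m <= n)%N -> Oh n u -> Oh m u.
Proof.
move=> mn /Oh_pos[C C0 HC]; exists C.
have /= : \forall h \near (0 : R), `|h| < 1 by exact: nbhs0_lt.
move: HC; apply: filterS2 => h uC h1; apply: le_trans uC _.
by rewrite ler_wpM2l// ler_wiXn2l// ltW.
Qed.

Lemma Oh_pow m n : (n <= m)%N -> Oh n (fun h => h ^+ m).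
Proof.
move=> nm; apply: Oh_le nm _; exists 1; apply: filterE => h.
by rewrite normrX mul1r.
Qed.

Lemma Oh_small u : Oh 1 u ->
  forall e, 0 < e -> \forall h \near (0 : R), `|u h| < e.
Proof.
move=> /Oh_pos[C C0 HC] e e0.
have C1 : 0 < C + 1 by rewrite ltr_wpDl.
have /= : \forall h \near (0 : R), `|h| < e / (C + 1).
  by apply: nbhs0_lt; rewrite divr_gt0.
move: HC; apply: filterS2 => h uC; rewrite ltr_pdivlMr// => hC.
apply: le_lt_trans uC _; apply: le_lt_trans hC; rewrite expr1 mulrC.
by rewrite ler_wpM2l// lerDl.
Qed.

Lemma Oh_prod I (r : seq I) (G : I -> R -> R) :
  (forall i, Oh 0 (G i)) -> Oh 0 (fun h => \prod_(i <- r) G i h).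
Proof.
move=> G0; elim: r => [|i r IH].
  by apply: Oh_eq (Oh_cst 1) => h; rewrite big_nil.
by apply: Oh_eq (OhM (G0 i) IH) => h; rewrite big_cons.
Qed.

(** Telescoping: F P - G Q = F (P - Q) + Q (F - G), where P and Q are the products over the tail.
    The factor F is bounded because G and F - G are. *)
Lemma Oh_prod_approx n I (r : seq I) (F G : I -> R -> R) :
  (forall i, Oh 0 (G i)) -> (forall i, Oh n (fun h => F i h - G i h)) ->
  Oh n (fun h => \prod_(i <- r) F i h - \prod_(i <- r) G i h).
Proof.
move=> G0 FG; elim: r => [|i r IH].
  by apply: Oh_eq (Oh0 n) => h; rewrite !big_nil subrr.
have F0 : Oh 0 (F i).
  by apply: Oh_eq (OhD (Oh_le (leq0n n) (FG i)) (G0 i)) => h; rewrite subrK.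
have H1 := OhM F0 IH; have H2 := OhM (Oh_prod r G0) (FG i).
by apply: Oh_eq (OhD H1 H2) => h; rewrite !big_cons; ring.
Qed.

(** If [c] were nonzero, any nonzero [h] with [|h| < |c| / (C + 1)] would violate the bound of order
    [m.+1]. *)
Lemma Oh_coef_eq0 c m n : (m < n)%N -> Oh n (fun h => h ^+ m * c) -> c = 0.
Proof.
move=> mn Oc; apply: contrapT => /eqP c0.
have [C C0 HC] : exists2 C : R, 0 <= C &
    \forall h \near (0 : R), `|h ^+ m * c| <= C * `|h| ^+ m.+1.
  exact/Oh_pos/(Oh_le mn).
have cC : 0 < `|c| / (C + 1) by rewrite divr_gt0 ?normr_gt0// ltr_wpDl.
have /= lt_h : \forall h \near (0 : R)^', `|h| < `|c| / (C + 1).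
  exact: dnbhs0_lt.
have [h [hC h0 {}HC]] : exists h, [/\ `|h| < `|c| / (C + 1), h != 0 &
    `|h ^+ m * c| <= C * `|h| ^+ m.+1].
  apply: (@filter_ex _ (0 : R)^'); near=> h; split.
  - by near: h.
  - by near: h; exact: nbhs_dnbhs_neq.
  - by near: h; exact: nbhs_dnbhs HC.
move: HC; rewrite normrM normrX exprS mulrA mulrC leNgt => /negP; apply.
rewrite ltr_pM2r ?exprn_gt0 ?normr_gt0//.
move: hC; rewrite ltr_pdivlMr ?ltr_wpDl// mulrDr mulr1 mulrC.
by apply: le_lt_trans; rewrite lerDl.
Unshelve. all: by end_near.
Qed.

(** Hypotheses on the symmetric interval cover both signs of [a], as needed for two-sided
    neighbourhoods of zero. *)
Lemma mean_value_bound (g g' : R -> R) (a B : R) :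
  (forall t, `|t| <= `|a| -> is_derive (t : R) (1 : R) g (g' t)) ->
  (forall t, `|t| <= `|a| -> `|g' t| <= B) -> `|g a - g 0| <= B * `|a|.
Proof.
move=> dg bg.
have wc (x y : R) : (forall t, x <= t <= y -> `|t| <= `|a|) ->
    {within `[x, y]%classic, continuous g}.
  move=> xy; apply: derivable_within_continuous => t; rewrite in_itv/= => /xy.
  by move=> /dg dgt; exact: ex_derive.
have [a0|a0] := leP 0 a.
  have sub t : 0 <= t <= a -> `|t| <= `|a|.
    by case/andP=> t0 ta; rewrite !ger0_norm.
  case: (@MVT_segment _ g g' 0 a a0 _ (wc _ _ sub)) => [t|c].
    by rewrite in_itv/= => /andP[/ltW t0 /ltW ta]; apply: dg; apply: sub; rewrite t0.
  rewrite in_itv/= => /sub ca ->; rewrite subr0 normrM ler_wpM2r//.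
  exact: bg.
have sub t : a <= t <= 0 -> `|t| <= `|a|.
  by case/andP=> ta t0; rewrite !ler0_norm ?lerN2// ltW.
case: (@MVT_segment _ g g' a 0 (ltW a0) _ (wc _ _ sub)) => [t|c].
  by rewrite in_itv/= => /andP[/ltW t0 /ltW ta]; apply: dg; apply: sub; rewrite t0.
rewrite in_itv/= => /sub ca; rewrite distrC => ->; rewrite sub0r normrM normrN.
by rewrite ler_wpM2r//; exact: bg.
Qed.

Lemma Oh_primitive n (g g' : R -> R) :
  (\forall t \near (0 : R), is_derive (t : R) (1 : R) g (g' t)) -> g 0 = 0 ->
  Oh n g' -> Oh n.+1 g.
Proof.
move=> dg g0 /Oh_pos[C C0 HC]; exists C.
have [e /= e0 He] := dg; have [r /= r0 Hr] := HC.
have /= : \forall h \near (0 : R), `|h| < Num.min e r.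
  by apply: nbhs0_lt; rewrite lt_min e0 r0.
apply: filterS => h; rewrite lt_min => /andP[he hr].
rewrite -[g h]subr0 -g0 exprSr mulrA; apply: (mean_value_bound (g' := g')) => t th.
  by apply: He; rewrite /= sub0r normrN (le_lt_trans th).
apply: (le_trans (Hr t _)); first by rewrite /= sub0r normrN (le_lt_trans th).
by rewrite ler_wpM2l// lerXn2r// nnegrE.
Qed.

Lemma Oh_uniform (I : finType) n (F : I -> R -> R) :
  (forall i, Oh n (F i)) ->
  exists2 C : R, 0 <= C &
    \forall h \near (0 : R), forall i, `|F i h| <= C * `|h| ^+ n.
Proof.
move=> H.
have {}H i : exists C : R, 0 <= C /\
    \forall h \near (0 : R), `|F i h| <= C * `|h| ^+ n.
  by have [C] := Oh_pos (H i); exists C.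
have [C {}H] := choice H; exists (\sum_i C i).
  by rewrite sumr_ge0// => i _; case: (H i).
near=> h => i; apply: (@le_trans _ _ (C i * `|h| ^+ n)).
  by move: i; near: h; apply: filter_forall => i; case: (H i).
rewrite ler_wpM2r ?exprn_ge0// (bigD1 i)//= lerDl.
by rewrite sumr_ge0// => j _; case: (H j).
Unshelve. all: by end_near. Qed.

(** An a priori bound for implicit linear systems: summing absolute values over [I] gives X <= |I| C
    |h|^n + |h| A X, and for small [h] the last term is at most X / 2 and moves to the left. *)
Lemma Oh_absorb (I : finType) n (x g : I -> R -> R) (a : I -> I -> R) :
  (\forall h \near (0 : R), forall i, x i h = g i h + h * \sum_j a i j * x j h) ->
  (forall i, Oh n (g i)) -> forall i, Oh n (x i).
Proof.
move=> xE /Oh_uniform[C C0 HC] i.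
pose A := \sum_i \sum_j `|a i j|.
have A0 : 0 <= A by rewrite sumr_ge0// => j _; rewrite sumr_ge0.
(* This threshold yields [|h| * A <= 1/2]; the added 1 keeps the denominator positive when
   [A = 0]. *)
have small : \forall h \near (0 : R), `|h| < (2 * (A + 1))^-1.
  by apply: nbhs0_lt; rewrite invr_gt0 mulr_gt0// ltr_wpDl.
exists (2 * (#|I|%:R * C)); near=> h.
have hA : `|h| * A <= 2^-1.
  have : `|h| < (2 * (A + 1))^-1 by near: h.
  have A1 : 0 < A + 1 by rewrite ltr_wpDl.
  rewrite invfM -ltr_pdivrMr ?invr_gt0// invrK => /ltW; apply: le_trans.
  by rewrite ler_wpM2l// lerDl.
have xEh : forall i, x i h = g i h + h * \sum_j a i j * x j h by near: h.
have gh : forall i, `|g i h| <= C * `|h| ^+ n by near: h.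
pose X := \sum_j `|x j h|.
have X0 : 0 <= X by rewrite sumr_ge0.
have xX j : `|x j h| <= X by rewrite /X (bigD1 j)//= lerDl sumr_ge0.
have : X <= #|I|%:R * C * `|h| ^+ n + (`|h| * A) * X.
  have -> : #|I|%:R * C * `|h| ^+ n = \sum_(j : I) C * `|h| ^+ n.
    by rewrite sumr_const mulr_natl mulrnAl.
  rewrite /A [`|h| * _]mulr_sumr [_ * X]mulr_suml -big_split /=; apply: ler_sum => j _.
  rewrite {1}xEh (le_trans (ler_normD _ _))// lerD// normrM -mulrA ler_wpM2l//.
  rewrite (le_trans (ler_norm_sum _ _ _))// mulr_suml; apply: ler_sum => k _.
  by rewrite normrM ler_wpM2l.
have : (`|h| * A) * X <= 2^-1 * X by rewrite ler_wpM2r.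
have := xX i; rewrite -mulrA -[2 * _ * _]mulrA; lra.
Unshelve. all: by end_near. Qed.

End PowerDomination.

(** * Taylor polynomials of vector-valued maps *)

Section Taylor.
Variable R : realType.

Lemma is_derive_sum_seq (I : Type) (r : seq I) (F : I -> R -> R) (dF : I -> R)
    (t : R) :
  (forall i, is_derive t (1 : R) (F i) (dF i)) ->
  is_derive t (1 : R) (fun x => \sum_(i <- r) F i x) (\sum_(i <- r) dF i).
Proof.
move=> H; elim: r => [|i r IH].
  rewrite big_nil (_ : (fun _ => _) = cst 0); first exact: is_derive_cst.
  by apply/funext => x; rewrite big_nil.
rewrite big_cons (_ : (fun _ => _) = F i + (fun x => \sum_(i <- r) F i x)).
  exact: is_deriveD.
by apply/funext => x; rewrite big_cons.
Qed.

Lemma is_derive_monomial (k : nat) (c t : R) :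
  is_derive t (1 : R) (fun x => x ^+ k.+1 * c) (t ^+ k * (k.+1%:R * c)).
Proof.
have H : is_derive t (1 : R) (c \*: ((id : R -> R) ^+ k.+1))
  (c *: ((k.+1%:R * t ^+ k) *: (1 : R))).
  exact: is_deriveZ.
rewrite (_ : (fun _ => _) = (c \*: ((id : R -> R) ^+ k.+1))).
  apply: is_derive_eq H _; rewrite /GRing.scale/=; ring.
by apply/funext => x; rewrite /GRing.scale/= exprfctE mulrC.
Qed.

Lemma is_derive_coord (d e : nat) (M : R -> 'M[R]_(d, e)) (t : R) D i j :
  is_derive t (1 : R) M D ->
  is_derive t (1 : R) (fun x => M x i j) (D i j).
Proof.
move=> [dM <-]; apply: DeriveDef; first exact: (derivable_mxP _ _ _).1.
by rewrite derive_mx// mxE.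
Qed.

Lemma is_derive_ray (d e : nat) (f : 'cV[R]_d -> 'cV[R]_e) y0 x (s : R) c :
  (forall z, differentiable f z) ->
  is_derive s (1 : R) (fun s => f (y0 + s *: x) c 0)
    (\sum_i x i 0 * ('D_(delta_mx i 0) f (y0 + s *: x)) c 0).
Proof.
move=> df; pose g := fun s : R => f (y0 + s *: x).
(* The difference quotient of [g] at [s] is that of [f] at [y0 + s *: x] in direction [x]; linearity
   of the differential then splits it into partial derivatives. *)
have E : (fun h : R => h^-1 *: ((g \o shift s) (h *: (1 : R)) - g s)) =
    (fun h => h^-1 *: ((f \o shift (y0 + s *: x)) (h *: x) - f (y0 + s *: x))).
  apply/funext => h; rewrite /g /=; congr (_ *: (f _ - _)).
  by rewrite [h *: (1 : R)]mulr1 scalerDl addrCA.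
have dg : derivable g s 1.
  by rewrite /derivable E; exact: diff_derivable.
have Dg : is_derive s (1 : R) g ('D_x f (y0 + s *: x)).
  by apply: DeriveDef => //; rewrite /derive E.
apply: (is_derive_eq (is_derive_coord c 0 Dg)).
have xE : x = \sum_i x i 0 *: delta_mx i 0.
  by rewrite {1}[x]matrix_sum_delta; apply: eq_bigr => i _; rewrite big_ord1.
rewrite deriveE//; move: (y0 + s *: x) => z; rewrite {1}xE linear_sum summxE.
by apply: eq_bigr => i _; rewrite linearZ mxE deriveE.
Qed.

(** A polynomial map as a list of (word of indices, vector coefficient). Words rather than
    multi-indices fit the ordered children of planar trees. *)
Definition monomials_at (d e : nat) (ms : seq (seq 'I_d * 'cV[R]_e))
    (x : 'cV[R]_d) : 'cV[R]_e :=
  \sum_(m <- ms) (\prod_(i <- m.1) x i 0) *: m.2.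

Lemma monomials_atE d e (ms : seq (seq 'I_d * 'cV[R]_e)) x c :
  monomials_at ms x c 0 = \sum_(m <- ms) (\prod_(i <- m.1) x i 0) * m.2 c 0.
Proof. by rewrite summxE; apply: eq_bigr => m _; rewrite mxE. Qed.

Lemma prod_scaled d (x : 'cV[R]_d) (s : R) (r : seq 'I_d) :
  \prod_(j <- r) (s *: x) j 0 = s ^+ size r * \prod_(j <- r) x j 0.
Proof.
elim: r => [|j r IH]; first by rewrite !big_nil mul1r.
by rewrite !big_cons IH mxE exprS; ring.
Qed.

(* Integrates the Taylor polynomials [ms i] of the partial derivatives along rays
   from the origin; this way no symmetry of mixed derivatives is needed. *)
Definition radial_primitive (d e : nat) (a : 'cV[R]_e)
    (ms : 'I_d -> seq (seq 'I_d * 'cV[R]_e)) :=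
  ([::], a) :: flatten
    [seq [seq (i :: m.1, (size m.1).+1%:R^-1 *: m.2) | m <- ms i] | i <- enum 'I_d].

Lemma radial_primitiveE d e (a : 'cV[R]_e)
    (ms : 'I_d -> seq (seq 'I_d * 'cV[R]_e)) (x : 'cV[R]_d) (s : R) c :
  monomials_at (radial_primitive a ms) (s *: x) c 0 = a c 0 +
  \sum_i \sum_(m <- ms i) s ^+ (size m.1).+1 *
     ((size m.1).+1%:R^-1 * (x i 0 * \prod_(j <- m.1) x j 0 * m.2 c 0)).
Proof.
rewrite monomials_atE big_cons big_nil mul1r; congr (_ + _).
rewrite big_flatten/= big_map big_enum/=; apply: eq_bigr => i _.
rewrite big_map; apply: eq_bigr => m _ /=.
rewrite big_cons !mxE.
rewrite prod_scaled exprS; ring.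
Qed.

(** Induction on [n]: the remainder along the ray through [x] has as derivative a combination of the
    remainders of the partial derivatives, so the mean value inequality on [0, 1] gains one power of
    [M]. *)
Lemma taylor (d e n : nat) (f : 'cV[R]_d -> 'cV[R]_e) (y0 : 'cV[R]_d) :
  Ck n f ->
  exists ms : seq (seq 'I_d * 'cV[R]_e), exists C r : R, 0 < r /\
    forall (x : 'cV[R]_d) (M : R), 0 <= M < r -> (forall i, `|x i 0| <= M) ->
    forall c, `|f (y0 + x) c 0 - monomials_at ms x c 0| <= C * M ^+ n.
Proof.
elim: n f => [|n IH] f /=.
  (* At order zero the polynomial is empty, and continuity bounds [f] near [y0] by [|f y0| + 1]. *)
  move=> cf; exists [::]; exists (`|f y0| + 1).
  have /cvgrPdist_lt/(_ 1 ltr01) := cf y0.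
  rewrite -nbhs_ballE => -[r /= r0 Hr]; exists r; split=> // x M /andP[M0 Mr] Hx c.
  rewrite monomials_atE big_nil subr0 expr0 mulr1.
  have {Hr} : `|f y0 - f (y0 + x)| < 1.
    apply: Hr; rewrite -ball_normE/= opprD addNKr normrN.
    rewrite /Num.Def.normr/= mx_normrE; apply/bigmax_ltP; split => //= i _.
    by rewrite ord1 (le_lt_trans (Hx _)).
  rewrite distrC => H.
  have : `|f (y0 + x) c 0| <= `|f (y0 + x)|.
    rewrite [leRHS]/Num.Def.normr/= mx_normrE.
    by apply: le_trans; last exact: (le_bigmax _ _ (c, 0)).
  move/le_trans; apply; rewrite -[f (y0 + x)](subrK (f y0)) addrC.
  by rewrite (le_trans (ler_normD _ _))// lerD2l ltW.
move=> [df dDf].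
have H i := IH _ (dDf (delta_mx i 0)).
have [ms {}H] := choice H; have [C {}H] := choice H; have [r {}H] := choice H.
(* The seed 1 of the minimum keeps the radius positive even when [d = 0]. *)
exists (radial_primitive (f y0) ms), (\sum_i C i), (\big[Num.min/1]_i r i).
split; first by apply/bigmin_gtP; split=> // i _; case: (H i).
move=> x M /andP[M0 Mr] Hx c.
pose psi (s : R) := f (y0 + s *: x) c 0 -
  monomials_at (radial_primitive (f y0) ms) (s *: x) c 0.
pose psi' (s : R) := \sum_i x i 0 * (('D_(delta_mx i 0) f (y0 + s *: x)) c 0
   - monomials_at (ms i) (s *: x) c 0).
have dpsi s : is_derive s (1 : R) psi (psi' s).
  pose A := fun s : R => f (y0 + s *: x) c 0.
  pose B := fun (i : 'I_d) (s : R) => \sum_(m <- ms i) s ^+ (size m.1).+1 *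
    ((size m.1).+1%:R^-1 * (x i 0 * \prod_(j <- m.1) x j 0 * m.2 c 0)).
  have -> : psi = A - (cst (f y0 c 0) + fun s => \sum_i B i s).
    by apply/funext => t; rewrite /psi radial_primitiveE.
  have dB i : is_derive s (1 : R) (B i) (x i 0 * monomials_at (ms i) (s *: x) c 0).
    apply: is_derive_eq.
      by apply: is_derive_sum_seq => m; exact: is_derive_monomial.
    rewrite monomials_atE mulr_sumr; apply: eq_bigr => m _.
    by rewrite prod_scaled mulVKf ?pnatr_eq0//; ring.
  have dS := is_derive_sum_seq (index_enum 'I_d) dB.
  have dA := is_derive_ray y0 x s c df.
  apply: is_derive_eq; rewrite add0r -sumrB; apply: eq_bigr => i _.
  by rewrite mulrBr.
have psi0 : psi 0 = 0.
  rewrite /psi radial_primitiveE scale0r addr0 big1 ?addr0 ?subrr// => i _.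
  by rewrite big1// => m _; rewrite expr0n mul0r.
have := @mean_value_bound R psi psi' 1 ((\sum_i C i) * M ^+ n.+1).
rewrite psi0 subr0 normr1 mulr1 /psi scale1r; apply=> // s s1.
rewrite /psi' (le_trans (ler_norm_sum _ _ _))// mulr_suml.
apply: ler_sum => i _; rewrite normrM exprS mulrCA ler_pM//.
have [_ /(_ (s *: x) M)] := H i; apply.
  by rewrite M0/= (lt_le_trans Mr)//; apply: bigmin_inf (lexx _).
by move=> j; rewrite mxE normrM -[M]mul1r ler_pM.
Qed.

End Taylor.

(** * Smoothness of polynomial maps *)

Section PolynomialMaps.
Variables (R : realType) (d e : nat).

Lemma derive_coordinate (i : 'I_d) (x v : 'cV[R]_d) :
  'D_v (fun z : 'cV[R]_d => z i 0) x = v i 0.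
Proof.
have did : derivable (id : 'cV[R]_d -> 'cV[R]_d) x v by exact: derivable_id.
by have /matrixP/(_ i 0) := derive_mx did; rewrite derive_id mxE => <-.
Qed.

Lemma derive_monomial (js : seq 'I_d) (v : 'cV[R]_d) :
  (forall x : 'cV[R]_d,
     differentiable (fun z : 'cV[R]_d => \prod_(i <- js) z i 0 : R) x) /\
  exists l : seq (R * seq 'I_d), forall x,
    'D_v (fun z : 'cV[R]_d => \prod_(i <- js) z i 0 : R) x =
    \sum_(m <- l) m.1 * \prod_(j <- m.2) x j 0.
Proof.
elim: js => [|i js [IHd [l IHl]]].
  have E : (fun z : 'cV[R]_d => \prod_(i <- [::]) z i 0 : R) = cst 1.
    by apply/funext => z; rewrite big_nil.
  rewrite E; split=> [x|]; first exact: differentiable_cst.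
  by exists [::] => x; rewrite big_nil derive_cst.
have E : (fun z : 'cV[R]_d => \prod_(j <- i :: js) z j 0 : R) =
    (fun z : 'cV[R]_d => z i 0 : R) * (fun z => \prod_(j <- js) z j 0).
  by apply/funext => z; rewrite big_cons.
rewrite E; split=> [x|].
  by apply: differentiableM => //; exact: differentiable_coord.
exists ((v i 0, js) :: [seq (m.1, i :: m.2) | m <- l]) => x.
rewrite deriveM; [|exact/diff_derivable/differentiable_coord|exact/diff_derivable].
rewrite IHl derive_coordinate big_cons big_map /= addrC [_ *: v i 0]mulrC.
congr (_ + _); rewrite /GRing.scale/= mulr_sumr; apply: eq_bigr => m _.
by rewrite big_cons mulrCA.
Qed.

(** Closure under directional derivatives is what lets smoothness follow by induction on the
    order. *)
Lemma derive_monomials_at (ms : seq (seq 'I_d * 'cV[R]_e)) (v : 'cV[R]_d) :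
  (forall x, differentiable (monomials_at ms) x) /\
  exists ms', (fun x => 'D_v (monomials_at ms) x) = monomials_at ms'.
Proof.
elim: ms => [|m ms [IHd [ms' IH]]].
  have -> : monomials_at [::] = cst 0 :> ('cV[R]_d -> 'cV[R]_e).
    by apply/funext => x; rewrite /monomials_at big_nil.
  split=> [x|]; first exact: differentiable_cst.
  by exists [::]; apply/funext => x; rewrite derive_cst /monomials_at big_nil.
have -> : monomials_at (m :: ms) =
    (fun x : 'cV[R]_d => (\prod_(i <- m.1) x i 0) *: m.2) + monomials_at ms.
  by apply/funext => x; rewrite /monomials_at big_cons.
have [dm [l Hl]] := derive_monomial m.1 v.
split=> [x|].
  by apply: differentiableD => //; exact: differentiableZl.
exists ([seq (a.2, a.1 *: m.2) | a <- l] ++ ms'); apply/funext => x.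
rewrite deriveD; [|exact/diff_derivable/differentiableZl|exact/diff_derivable].
have /(congr1 (fun g => g x)) /= -> := IH.
rewrite /monomials_at big_cat big_map /=; congr (_ + _).
rewrite deriveE; last exact: differentiableZl.
rewrite diffZl// -deriveE// Hl scaler_suml; apply: eq_bigr => a _.
by rewrite scalerA mulrC.
Qed.

Lemma smooth_monomials_at (ms : seq (seq 'I_d * 'cV[R]_e)) :
  smooth (monomials_at ms).
Proof.
move=> k; elim: k ms => [|k IH] ms /=.
  by move=> x; have [+ _] := derive_monomials_at ms 0 => /(_ x);
     exact: differentiable_continuous.
split=> [x|v]; first by have [] := derive_monomials_at ms 0.
by have [_ [ms' ->]] := derive_monomials_at ms v.
Qed.

End PolynomialMaps.

(** * Trees: equality, induction, subtrees and weights *)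

HB.instance Definition _ (N : nat) := gen_eqMixin (tw N).

Section TreeFacts.
Variables (R : realType) (N : nat).

(** The generated principle gives no hypothesis on the trees inside the list of children, hence the
    explicit nested fixpoint. *)
Lemma tw_nested_ind (P : tw N -> Prop) :
  (forall c ch, {in ch, forall u, P u} -> P (Round c ch)) ->
  (forall c u, P u -> P (Square c u)) -> forall t, P t.
Proof.
move=> HR HS; fix IH 1 => -[c ch|c u]; last exact/HS/IH.
(* Clearing [IH] prevents the impossible case from being closed by an unguarded recursive call. *)
apply: HR; elim: ch => [|v ch IHch] u; first by clear IH.
rewrite inE => /orP[/eqP ->|]; [exact: IH|exact: IHch].
Qed.

Fixpoint subtrees (t : tw N) : seq (tw N) :=
  t :: match t with
       | Round _ ch => flatten (map subtrees ch)
       | Square _ u => subtrees u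
       end.

Definition children (t : tw N) : seq (tw N) :=
  match t with Round _ ch => ch | Square _ u => [:: u] end.

Lemma mem_subtrees t : t \in subtrees t.
Proof. by case: t => *; rewrite inE eqxx. Qed.

Lemma subtrees_closed t u :
  u \in subtrees t -> {subset children u <= subtrees t}.
Proof.
elim/tw_nested_ind: t u => [c ch IH|c t IH] u /=; rewrite inE.
  case/orP=> [/eqP -> v /= vch|/flatten_mapP[w wch uw] v vu].
    rewrite inE; apply/orP; right; apply/flatten_mapP; exists v => //.
    exact: mem_subtrees.
  rewrite inE; apply/orP; right; apply/flatten_mapP; exists w => //.
  exact: (IH w wch u uw).
case/orP=> [/eqP -> v /=|/IH ut v /ut vt]; last by rewrite inE vt orbT.
by rewrite mem_seq1 => /eqP ->; rewrite inE mem_subtrees orbT.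
Qed.

(** The coefficient of [t] in the exact flow; it vanishes on trees with a square vertex because the
    flow does not see the matrices [L]. *)
Definition exact_weight (t : tw N) : R :=
  if only_round t then ((density t)%:R)^-1 else 0.

Lemma rho_gt0 (t : tw N) : (0 < rho t)%N.
Proof. by case: t. Qed.

(** This is the differential equation on coefficients: differentiating [h ^+ rho t] produces the
    factor [rho t], which cancels the root factor of the density. A child with a square vertex makes
    both sides zero. *)
Lemma exact_weight_Round c ch :
  (rho (Round c ch))%:R * exact_weight (Round c ch) =
  \prod_(u <- ch) exact_weight u.
Proof.
have -> : \prod_(u <- ch) exact_weight u =
  if all (@only_round N) ch then ((foldr muln 1%N (map (@density N) ch))%:R)^-1
  else 0.
  elim: ch => [|u ch IH]; first by rewrite big_nil invr1.
  rewrite big_cons IH /exact_weight /=; case: (only_round u) => /=; last by rewrite mul0r.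
  by case: all; rewrite ?mulr0// natrM invfM.
rewrite /exact_weight /=; case: all; last by rewrite mulr0.
by rewrite natrM invfM mulVKf// pnatr_eq0.
Qed.

Lemma prod_pow_rho (h : R) (g : tw N -> R) ch :
  \prod_(u <- ch) (h ^+ rho u * g u) =
  h ^+ sumn (map (@rho N) ch) * \prod_(u <- ch) g u.
Proof.
elim: ch => [|u ch IH]; first by rewrite !big_nil mul1r.
by rewrite !big_cons IH /= exprD; ring.
Qed.

Variable s : 'I_N -> nat.
Variables (alpha gamma : forall q m : 'I_N, 'M[R]_(s q, s m)).
Local Notation theta := (theta alpha gamma).

(** The coefficient of [t] in the argument of the field ([A] = [alpha]) or in the vector multiplied
    by [L] ([A] = [gamma]) at stage [i]. *)
Definition stage_weight (A : forall q m : 'I_N, 'M[R]_(s q, s m)) q (i : 'I_(s q))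
    (t : tw N) : R :=
  \sum_m \sum_j A q m i j * theta t m j 0.

Lemma stage_weightE A q (i : 'I_(s q)) t :
  (\sum_(m < N) A q m *m theta t m) i ord0 = stage_weight A i t.
Proof. by rewrite summxE; apply: eq_bigr => m _; rewrite mxE. Qed.

Lemma theta_Round c ch q i :
  theta (Round c ch) q i 0 =
  if c == q then \prod_(u <- ch) stage_weight alpha i u else 0.
Proof.
rewrite /=; case: eqP => _; last by rewrite mxE.
elim: ch => [|u ch IH]; first by rewrite mxE big_nil.
by rewrite mxE big_cons stage_weightE IH.
Qed.

Lemma theta_Square c u q i :
  theta (Square c u) q i 0 = if c == q then stage_weight gamma i u else 0.
Proof. by rewrite /=; case: eqP => _; rewrite ?stage_weightE ?mxE. Qed.

Lemma phiE b t : phi alpha gamma b t = \sum_q \sum_i b q i 0 * theta t q i 0.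
Proof.
by apply: eq_bigr => q _; rewrite mxE; apply: eq_bigr => i _; rewrite mxE.
Qed.

End TreeFacts.

(** * The test system attached to a list of trees closed under children *)

Section TestProblem.
Variables (R : realType) (N : nat) (S : seq (tw N)).
Hypothesis S_closed : forall u, u \in S -> {subset children u <= S}.

Local Notation d := (size S).
Local Notation tree := (tnth (in_tuple S)).

(* One coordinate per tree of [S]; the equation of coordinate [Round c ch] is
   y' = product of the coordinates of [ch], placed in the field of color [c],
   while [Square c u] only enters through the matrix of color [c]. *)
Definition positions (ch : seq (tw N)) : seq 'I_d :=
  pmap (fun u => insub (index u S)) ch.

Definition test_monomials (c : 'I_N) : seq (seq 'I_d * 'cV[R]_d) :=
  flatten [seq if tree i is Round c' ch then
                 if c' == c then [:: (positions ch, delta_mx i 0)] else [::]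
               else [::] | i <- enum 'I_d].

Definition test_field c := monomials_at (test_monomials c).

Definition test_matrix (c : 'I_N) : 'M[R]_d :=
  \matrix_(i, j) if tree i is Square c' u then
                   ((c' == c) && (j == index u S :> nat))%:R else 0.

(** Coordinates depend on the tree only, so repetitions in [S] are harmless although [index] always
    selects the first occurrence. *)
Definition tree_vector (g : tw N -> R) : 'cV[R]_d := \col_i g (tree i).

Lemma tree_index u (H : (index u S < d)%N) : tree (Ordinal H) = u.
Proof. by rewrite (tnth_nth u) /= nth_index// -index_mem. Qed.

Lemma prod_positions g ch : {subset ch <= S} ->
  \prod_(i <- positions ch) tree_vector g i 0 = \prod_(u <- ch) g u.
Proof.
elim: ch => [|u ch IH] sub; first by rewrite !big_nil.
have uS : (index u S < d)%N by rewrite index_mem sub ?inE ?eqxx.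
rewrite /positions /= insubT /= !big_cons IH; last first.
  by move=> v vch; rewrite sub// inE vch orbT.
by rewrite mxE tree_index.
Qed.

Lemma test_fieldE c g : test_field c (tree_vector g) =
  tree_vector (fun t => if t is Round c' ch then
     if c' == c then \prod_(u <- ch) g u else 0 else 0).
Proof.
apply/colP => i; rewrite monomials_atE big_flatten /= big_map big_enum /= mxE.
(* The monomial of coordinate [j] carries the unit vector [delta_mx j 0], so only [j = i] reaches
   row [i]. *)
rewrite (bigD1 i)//= [X in _ + X]big1 ?addr0; last first.
  move=> j ji; case: (tree j) => [c' ch|]; last by rewrite big_nil.
  by case: eqP => _; rewrite ?big_nil// big_seq1 mxE eq_sym (negbTE ji) mulr0.
have := mem_tnth i (in_tuple S).
case: (tree i) => [c' ch|] iS; last by rewrite big_nil.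
case: eqP => _; last by rewrite big_nil.
by rewrite big_seq1 mxE !eqxx mulr1 prod_positions//; exact: (S_closed iS).
Qed.

Lemma test_matrixE c g : test_matrix c *m tree_vector g =
  tree_vector (fun t => if t is Square c' u then
     if c' == c then g u else 0 else 0).
Proof.
apply/colP => i; rewrite !mxE.
have := mem_tnth i (in_tuple S); case E : (tree i) => [c' ch|c' u] iS.
  by rewrite big1// => j _; rewrite mxE E mul0r.
have uS : (index u S < d)%N.
  by rewrite index_mem; apply: (S_closed iS); rewrite inE.
rewrite (bigD1 (Ordinal uS))//= big1 ?addr0; last first.
  move=> j ji; rewrite mxE E; have -> : (j == index u S :> nat) = false.
    by apply: contraNF ji => /eqP ji; apply/eqP/val_inj.
  by rewrite andbF mul0r.
by rewrite !mxE E eqxx andbT tree_index; case: (c' == c); rewrite ?mul1r ?mul0r.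
Qed.

Lemma sum_tree_vector I (r : seq I) (P : pred I) (F : I -> tw N -> R) :
  \sum_(i <- r | P i) tree_vector (F i) =
  tree_vector (fun t => \sum_(i <- r | P i) F i t).
Proof.
by apply/colP => k; rewrite summxE mxE; apply: eq_bigr => i _; rewrite mxE.
Qed.

Lemma scale_tree_vector a g :
  a *: tree_vector g = tree_vector (fun t => a * g t).
Proof. by apply/colP => k; rewrite !mxE. Qed.

Variable s : 'I_N -> nat.
Variables (alpha gamma : forall q m : 'I_N, 'M[R]_(s q, s m)).
Hypothesis alpha0 : forall (q m : 'I_N) (i : 'I_(s q)) (j : 'I_(s m)),
  (i <= j)%N -> alpha q m i j = 0.
Hypothesis gamma0 : forall (q m : 'I_N) (i : 'I_(s q)) (j : 'I_(s m)),
  (i < j)%N -> gamma q m i j = 0.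

Definition test_stage (h : R) q (i : 'I_(s q)) :=
  tree_vector (fun t => h ^+ rho t * theta alpha gamma t q i 0).

Lemma sum_test_stages h (A : forall q m : 'I_N, 'M[R]_(s q, s m)) q (i : 'I_(s q))
    (P : pred nat) :
  (forall m (j : 'I_(s m)), ~~ P j -> A q m i j = 0) ->
  \sum_(m < N) \sum_(j < s m | P j) A q m i j *: test_stage h j =
  tree_vector (fun t => h ^+ rho t * stage_weight alpha gamma A i t).
Proof.
move=> A0; apply/colP => k; rewrite mxE summxE mulr_sumr.
apply: eq_bigr => m _; rewrite summxE mulr_sumr [RHS](bigID (fun j => P (val j)))/=.
(* The method truncates its sums while [theta] uses full matrices; the terms in between vanish by
   the triangular shape. *)
rewrite [X in _ = _ + X]big1 ?addr0; last by move=> j /A0 ->; rewrite mul0r mulr0.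
by apply: eq_bigr => j _; rewrite !mxE mulrCA.
Qed.

(** On the test system the stage equations reduce to the recursion of [theta]: the explicit [h]
    accounts for the root and the children supply the remaining powers. *)
Lemma test_stages h :
  gark_row_stages alpha gamma test_field test_matrix 0 h (test_stage h).
Proof.
move=> q i; rewrite add0r.
rewrite (@sum_test_stages h alpha q i (fun j => (j < i)%N)); last first.
  by move=> m j; rewrite -leqNgt; exact: alpha0.
rewrite (@sum_test_stages h gamma q i (fun j => (j <= i)%N)); last first.
  by move=> m j; rewrite -ltnNge; exact: gamma0.
rewrite test_fieldE test_matrixE !scale_tree_vector; apply/colP => k; rewrite !mxE.
case: (tree k) => [c ch|c u].
  rewrite theta_Round prod_pow_rho mulr0 addr0 /=; case: eqP => _; last by rewrite !mulr0.
  by rewrite exprS mulrA.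
rewrite theta_Square mulr0 add0r /=; case: eqP => _; last by rewrite !mulr0.
by rewrite exprS mulrA.
Qed.

Definition test_solution (h : R) :=
  tree_vector (fun t => h ^+ rho t * exact_weight R t).

(** A round coordinate follows from [exact_weight_Round], only the field of the root color
    contributing; a square coordinate is identically zero and so is its derivative. *)
Lemma test_exact_solution : exact_solution test_field 0 test_solution.
Proof.
split.
  by apply/colP => k; rewrite !mxE expr0n; have := rho_gt0 (tree k);
     case: (rho _) => //= n _; rewrite mul0r.
apply: filterE => t.
have dk (k : 'I_d) j : is_derive t (1 : R) (fun x => test_solution x k j)
    ((\sum_(m < N) test_field m (test_solution t)) k j).
  rewrite ord1; under eq_bigr do rewrite test_fieldE.
  rewrite sum_tree_vector mxE.
  rewrite (_ : (fun _ => _) = fun x => x ^+ (rho (tree k)).-1.+1 * exact_weight R (tree k)).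
    apply: (is_derive_eq (is_derive_monomial _ _ _)); rewrite prednK ?rho_gt0//.
    case: (tree k) => [c ch|c u].
      rewrite exact_weight_Round (bigD1 c)//= eqxx [X in _ + X]big1 ?addr0 ?prod_pow_rho//.
      by move=> m; rewrite eq_sym => /negbTE ->.
    by rewrite /exact_weight /= !mulr0 big1.
  by apply/funext => x; rewrite mxE prednK ?rho_gt0.
apply: DeriveDef; first by apply/derivable_mxP => k j; case: (dk k j).
rewrite derive_mx; last by apply/derivable_mxP => k j; case: (dk k j).
by apply/matrixP => k j; rewrite mxE; case: (dk k j).
Qed.

End TestProblem.

(** * Passage between vector and coordinatewise estimates, through the max norm *)

Section LandauComponents.
Variables (R : realType) (d : nat).

Lemma Oh_of_eqO n (u : R -> 'cV[R]_d) (i : 'I_d) :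
  u =O_ (0 : R) (fun h : R => h ^+ n) -> Oh n (fun h => u h i 0).
Proof.
move=> /eqO_exP[C C0 HC]; exists C; apply: filterS HC => h; rewrite normrX.
apply: le_trans; rewrite [leRHS]/Num.Def.normr/= mx_normrE.
by apply: le_trans; last exact: (le_bigmax _ _ (i, 0)).
Qed.

Lemma eqO_of_Oh n (u : R -> 'cV[R]_d) :
  (forall i : 'I_d, Oh n (fun h => u h i 0)) ->
  u =O_ (0 : R) (fun h : R => h ^+ n).
Proof.
move=> /Oh_uniform[C C0 HC]; apply/eqO_exP; exists (C + 1); first by rewrite ltr_wpDl.
apply: filterS HC => h HC; rewrite normrX [leLHS]/Num.Def.normr/= mx_normrE.
apply/bigmax_leP; split; first by rewrite mulr_ge0 ?exprn_ge0// addr_ge0.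
move=> [i j] _ /=; rewrite ord1 (le_trans (HC i))// ler_wpM2r ?exprn_ge0//.
by rewrite lerDl.
Qed.

End LandauComponents.

(** * Necessity of the order conditions *)

Lemma order_conditions_necessary (R : realType) (N : nat) (s : 'I_N -> nat)
    (alpha gamma : forall q m : 'I_N, 'M[R]_(s q, s m))
    (b : forall q : 'I_N, 'cV[R]_(s q)) (p : nat) :
  (forall (q m : 'I_N) (i : 'I_(s q)) (j : 'I_(s m)),
      (i <= j)%N -> alpha q m i j = 0) ->
  (forall (q m : 'I_N) (i : 'I_(s q)) (j : 'I_(s m)),
      (i < j)%N -> gamma q m i j = 0) ->
  gark_row_order alpha gamma b p ->
  forall t : tw N, (rho t <= p)%N -> phi alpha gamma b t = exact_weight R t.
Proof.
move=> a0 g0 ord t tp; pose S := subtrees t.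
have Scl : forall u, u \in S -> {subset children u <= S}.
  by move=> u; exact: subtrees_closed.
have := ord (size S) (@test_field R N S) (@test_matrix R N S) 0
  (@test_stage R N S s alpha gamma) (@test_solution R N S).
move=> /(_ (fun m => smooth_monomials_at _)).
move=> /(_ (filterE _ (test_stages Scl a0 g0)) (test_exact_solution R Scl)).
have tS : (index t S < size S)%N by rewrite index_mem mem_subtrees.
move=> /(Oh_of_eqO (Ordinal tS)) H.
apply/eqP; rewrite -subr_eq0; apply/eqP.
(* The error in the coordinate of [t] is exactly [h ^+ rho t] times the defect, and
   [rho t < p.+1]. *)
apply: (@Oh_coef_eq0 _ _ (rho t) p.+1) => //; apply: Oh_eq H => h.
rewrite /gark_row_output add0r !mxE summxE tree_index mulrBr; congr (_ - _).
rewrite phiE mulr_sumr; apply: eq_bigr => q _.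
rewrite summxE mulr_sumr; apply: eq_bigr => i _.
by rewrite !mxE tree_index mulrCA.
Qed.

(** * Truncated expansions indexed by trees *)

Section Expansions.
Variables (R : realType) (N d : nat).
Implicit Types (l : seq (tw N * 'cV[R]_d)) (a w : tw N -> R).

(** A B-series with weights [a] kept apart from the list [l], so that stages and exact solution can
    share one list. *)
Definition series l a (h : R) (c : 'I_d) : R :=
  \sum_(t <- l) h ^+ rho t.1 * a t.1 * t.2 c 0.

(** The series divided by [h], that is, with the power due to the root removed. *)
Definition reduced_series l a (h : R) (c : 'I_d) : R :=
  \sum_(t <- l) h ^+ (rho t.1).-1 * a t.1 * t.2 c 0.

Lemma series_reduced l a h c : series l a h c = h * reduced_series l a h c.
Proof.
rewrite /reduced_series mulr_sumr; apply: eq_bigr => t _.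
by rewrite !mulrA -exprS prednK// rho_gt0.
Qed.

Lemma Oh_series l a c : Oh 1 (fun h => series l a h c).
Proof.
apply: Oh_sum => t _; apply: OhMr; apply: OhMr; apply: Oh_pow; exact: rho_gt0.
Qed.

Lemma is_derive_series l a c (h : R) :
  is_derive h (1 : R) (fun x => series l a x c)
    (reduced_series l (fun t => (rho t)%:R * a t) h c).
Proof.
apply: (is_derive_sum_seq l) => t.
rewrite (_ : (fun _ => _) = fun x => x ^+ (rho t.1).-1.+1 * (a t.1 * t.2 c 0)).
  apply: (is_derive_eq (is_derive_monomial _ _ _)).
  by rewrite prednK ?rho_gt0// !mulrA.
by apply/funext => x; rewrite prednK ?rho_gt0// mulrA.
Qed.

(** Multiplies out a monomial in series: each entry is an ordered forest, one tree per factor, with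
    its scalar coefficient. *)
Fixpoint expand l (js : seq 'I_d) : seq (seq (tw N) * R) :=
  if js is j :: js' then
    [seq (t.1 :: r.1, t.2 j 0 * r.2) | t : tw N * 'cV[R]_d <- l,
                                       r : seq (tw N) * R <- expand l js']
  else [:: ([::], 1)].

Lemma prod_expand l js (A : tw N -> R) :
  \prod_(j <- js) (\sum_(t <- l) A t.1 * t.2 j 0) =
  \sum_(r <- expand l js) (\prod_(u <- r.1) A u) * r.2.
Proof.
elim: js => [|j js IH]; first by rewrite !big_nil big_seq1 big_nil mul1r.
rewrite big_cons IH /= big_allpairs_dep /= mulr_suml; apply: eq_bigr => t _.
rewrite mulr_sumr; apply: eq_bigr => r _ /=.
by rewrite big_cons; ring.
Qed.

(** The list obtained by substituting a series into the Taylor polynomial [ms]: every resulting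
    forest is joined under a round root of color [q]. *)
Definition grafts (q : 'I_N) (ms : seq (seq 'I_d * 'cV[R]_d)) l :=
  flatten [seq [seq (Round q r.1, r.2 *: m.2) | r <- expand l m.1] | m <- ms].

Lemma reduced_series_grafts q ms l a w h c :
  (forall ch, w (Round q ch) = \prod_(u <- ch) a u) ->
  reduced_series (grafts q ms l) w h c =
  \sum_(m <- ms) (\prod_(j <- m.1) series l a h j) * m.2 c 0.
Proof.
move=> wE; rewrite /reduced_series big_flatten big_map; apply: eq_bigr => m _.
rewrite (prod_expand l m.1 (fun t => h ^+ rho t * a t)) big_map mulr_suml; apply: eq_bigr => r _ /=.
by rewrite prod_pow_rho wE mxE !mulrA.
Qed.

Lemma reduced_series_grafts0 q ms l w h c :
  (forall ch, w (Round q ch) = 0) -> reduced_series (grafts q ms l) w h c = 0.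
Proof.
move=> w0; rewrite /reduced_series big_flatten big_map big1// => m _.
by rewrite big_map big1// => r _; rewrite w0 mulr0 mul0r.
Qed.

Definition approx n l a (u : R -> 'cV[R]_d) : Prop :=
  forall c, Oh n (fun h => u h c 0 - series l a h c).

Lemma approx_Oh1 n l a u : (0 < n)%N -> approx n l a u ->
  forall c, Oh 1 (fun h => u h c 0).
Proof.
move=> n0 H c; apply: Oh_eq (OhD (Oh_le n0 (H c)) (Oh_series l a c)) => h.
by rewrite subrK.
Qed.

(** The polynomial [ms] is chosen before [l], [a] and [u], so the same one serves every stage and
    the exact solution. *)
Lemma field_approx n (f : 'cV[R]_d -> 'cV[R]_d) (y0 : 'cV[R]_d) : Ck n f ->
  exists ms : seq (seq 'I_d * 'cV[R]_d), forall l a u, (0 < n)%N ->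
    approx n l a u -> forall c, Oh n (fun h => f (y0 + u h) c 0 -
      \sum_(m <- ms) (\prod_(j <- m.1) series l a h j) * m.2 c 0).
Proof.
move=> /(taylor y0)[ms [C [r [r0 Hms]]]]; exists ms => l a u n0 H c.
have u1 := approx_Oh1 n0 H.
have H1 : Oh n (fun h => f (y0 + u h) c 0 - monomials_at ms (u h) c 0).
  have [B B0 HB] := Oh_uniform u1.
  (* The Taylor bound is applied with [M = B * |h|], which is below the radius [r] for small [h]. *)
  exists (C * B ^+ n); near=> h.
  have uB : forall i, `|u h i 0| <= B * `|h| by near: h; move: HB.
  rewrite -mulrA -exprMn; apply: Hms => //; rewrite mulr_ge0//=.
  have : `|B * h| < r.
    by near: h; apply: Oh_small => //; apply: OhMl; exact: Oh_id.
  by rewrite normrM ger0_norm.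
have H2 : Oh n (fun h => monomials_at ms (u h) c 0 -
    \sum_(m <- ms) (\prod_(j <- m.1) series l a h j) * m.2 c 0).
  have : Oh n (fun h => \sum_(m <- ms) (\prod_(j <- m.1) u h j 0 -
      \prod_(j <- m.1) series l a h j) * m.2 c 0).
    apply: Oh_sum => m _; apply: OhMr.
    apply: (Oh_prod_approx (F := fun j h => u h j 0) _ _ H) => j.
    exact: Oh_le (Oh_series _ _ _).
  apply: Oh_eq => h; rewrite monomials_atE -sumrB.
  by apply: eq_bigr => m _; rewrite mulrBl.
by apply: Oh_eq (OhD H1 H2) => h; rewrite addrA subrK.
Unshelve. all: by end_near. Qed.

End Expansions.

(** * Sufficiency of the order conditions *)

Section Sufficiency.
Variables (R : realType) (N : nat) (s : 'I_N -> nat).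
Variables (alpha gamma : forall q m : 'I_N, 'M[R]_(s q, s m)).
Hypothesis alpha0 : forall (q m : 'I_N) (i : 'I_(s q)) (j : 'I_(s m)),
  (i <= j)%N -> alpha q m i j = 0.
Hypothesis gamma0 : forall (q m : 'I_N) (i : 'I_(s q)) (j : 'I_(s m)),
  (i < j)%N -> gamma q m i j = 0.
Variables (d : nat) (f : 'I_N -> 'cV[R]_d -> 'cV[R]_d) (L : 'I_N -> 'M[R]_d).
Variables (y0 : 'cV[R]_d) (K : R -> forall q : 'I_N, 'I_(s q) -> 'cV[R]_d).
Variable y : R -> 'cV[R]_d.
Hypothesis fsmooth : forall m, smooth (f m).
Hypothesis Kstages :
  \forall h \near (0 : R), gark_row_stages alpha gamma f L y0 h (K h).
Hypothesis ysol : exact_solution f y0 y.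

Local Notation theta := (theta alpha gamma).
Local Notation arg q i h :=
  (\sum_(m < N) \sum_(j < s m | (j < i)%N) alpha q m i j *: K h j).
Local Notation lin q i h :=
  (\sum_(m < N) \sum_(j < s m | (j <= i)%N) gamma q m i j *: K h j).

Lemma field_bounded q (u : R -> 'cV[R]_d) :
  (forall c, Oh 1 (fun h => u h c 0)) ->
  forall c, Oh 0 (fun h => f q (y0 + u h) c 0).
Proof.
move=> u1 c; have [ms Hms] := field_approx N y0 (@fsmooth q 1).
have u1' : @approx R N d 1 [::] (fun=> 0) u.
  by move=> e; apply: Oh_eq (u1 e) => h; rewrite /series big_nil subr0.
have H := Hms [::] (fun=> 0) u isT u1' c.
have H0 : Oh 0 (fun h : R => \sum_(m <- ms) (\prod_(j <- m.1)
   (@series R N d [::] (fun=> 0) h j)) * m.2 c 0).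
  apply: Oh_sum => m _; apply: OhMr; apply: Oh_prod => j.
  exact: Oh_le (Oh_series _ _ _).
by apply: Oh_eq (OhD (Oh_le (leq0n 1) H) H0) => h; rewrite subrK.
Qed.

(** Induction on the stage index: arguments of the fields involve only earlier stages, so the field
    values are bounded, while the implicit coupling through [gamma] carries a factor [h] and is
    handled by [Oh_absorb]. *)
Lemma stages_Oh1 q (i : 'I_(s q)) c : Oh 1 (fun h => K h i c 0).
Proof.
suff H k : forall q (i : 'I_(s q)) c, (i < k)%N -> Oh 1 (fun h => K h i c 0).
  exact: H (ltnSn i).
elim: k {q i c} => [//|k IH] q i c ik.
(* The unknowns are the coordinates of all stages of all partitions; those of index above [k] are
   replaced by zero. *)
pose I := ({q : 'I_N & 'I_(s q)} * 'I_d)%type.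
pose x (z : I) h := if (tagged z.1 < k.+1)%N then K h (tagged z.1) z.2 0 else 0.
pose g (z : I) h := if (tagged z.1 < k.+1)%N then
   h * f (tag z.1) (y0 + arg (tag z.1) (tagged z.1) h) z.2 0 else 0.
pose a (z w : I) := if ((tagged w.1 <= tagged z.1) && (tagged z.1 < k.+1))%N then
   L (tag z.1) z.2 w.2 * gamma (tag z.1) (tag w.1) (tagged z.1) (tagged w.1) else 0.
have := @Oh_absorb R I 1 x g a _ _ (Tagged _ i, c).
rewrite /x /= ik; apply.
  apply: filterS Kstages => h Kh [[q' i'] c'].
  rewrite /x /g /a /=; case ik' : (i' < k.+1)%N; last first.
    by rewrite add0r big1 ?mulr0// => w _; rewrite andbF mul0r.
  rewrite {1}(Kh q' i') mxE; congr (_ + _); first by rewrite mxE.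
  rewrite !mxE; congr (_ * _).
  rewrite -(pair_bigA _ (fun (z : {q : 'I_N & 'I_(s q)}) (e : 'I_d) =>
    (if (tagged z <= i')%N && true then
       L q' c' e * gamma q' (tag z) i' (tagged z) else 0) *
    (if (tagged z < k.+1)%N then K h (tagged z) e 0 else 0)))/=.
  rewrite exchange_big /=; apply: eq_bigr => e _.
  rewrite summxE mulr_sumr.
  transitivity (\sum_(m < N) \sum_(j < s m)
    (if (j <= i')%N && true then L q' c' e * gamma q' m i' j else 0) *
    (if (j < k.+1)%N then K h j e 0 else 0)); last by rewrite sig_big_dep.
  apply: eq_bigr => m _; rewrite summxE mulr_sumr big_mkcond.
  apply: eq_bigr => j _; rewrite andbT mxE; case: (leqP j i') => ji; last by rewrite mul0r.
  by rewrite (leq_ltn_trans ji ik') mulrA.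
move=> [[q' i'] c']; rewrite /g /=; case ik' : (i' < k.+1)%N; last exact: Oh0.
apply: (@OhM _ 1 0 id _ (Oh_id R)); apply: (@field_bounded q' (fun h => arg q' i' h)).
move=> e; have : Oh 1 (fun h => \sum_(m < N) \sum_(j < s m | (j < i')%N)
    alpha q' m i' j * K h j e 0).
  apply: Oh_sum => m _; apply: Oh_sum => j ji; apply: OhMl; apply: IH.
  exact: leq_trans ji ik'.
apply: Oh_eq => h; rewrite summxE; apply: eq_bigr => m _; rewrite summxE.
by apply: eq_bigr => j _; rewrite mxE.
Qed.

Lemma combination_approx n l (A : forall q m : 'I_N, 'M[R]_(s q, s m)) q
    (i : 'I_(s q)) (P : pred nat) :
  (forall q (i : 'I_(s q)), approx n l (fun t => theta t q i 0) (fun h => K h i)) ->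
  (forall m (j : 'I_(s m)), ~~ P j -> A q m i j = 0) ->
  approx n l (stage_weight alpha gamma A i)
    (fun h => \sum_(m < N) \sum_(j < s m | P j) A q m i j *: K h j).
Proof.
move=> HK A0 c.
have : Oh n (fun h => \sum_(m < N) \sum_(j < s m | P j) A q m i j *
    (K h j c 0 - series l (fun t => theta t m j 0) h c)).
  by apply: Oh_sum => m _; apply: Oh_sum => j _; apply: OhMl; exact: HK.
apply: Oh_eq => h; rewrite summxE.
have -> : series l (stage_weight alpha gamma A i) h c = \sum_(m < N)
    \sum_(j < s m | P j) A q m i j * series l (fun t => theta t m j 0) h c.
  transitivity (\sum_(m < N) \sum_(j < s m)
      A q m i j * series l (fun t => theta t m j 0) h c).
    rewrite /series; under [RHS]eq_bigr do under eq_bigr do rewrite mulr_sumr.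
    under [RHS]eq_bigr do rewrite exchange_big.
    rewrite exchange_big /=; apply: eq_bigr => t _.
    rewrite /stage_weight mulr_sumr mulr_suml; apply: eq_bigr => m _.
    rewrite mulr_sumr mulr_suml; apply: eq_bigr => j _; ring.
  apply: eq_bigr => m _; rewrite (bigID (fun j => P (val j)))/=.
  by rewrite [X in _ + X]big1 ?addr0// => j /A0 ->; rewrite mul0r.
rewrite -sumrB; apply: eq_bigr => m _; rewrite summxE -sumrB.
by apply: eq_bigr => j _; rewrite mxE mulrBr.
Qed.

(** Carathéodory's form of the derivative at 0 writes the increment as [g h * h] with [g] continuous
    at 0. *)
Lemma solution_Oh1 c : Oh 1 (fun h => y h c 0 - y0 c 0).
Proof.
have [y00 dy] := ysol.
have d0 := is_derive_coord c 0 (nbhs_singleton dy).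
have [g [gE gc _]] := (is_derive1_caratheodory _ _ _).1 d0.
have g0 : Oh 0 g.
  have /cvgrPdist_lt/(_ 1 ltr01) := gc => H; exists (`|g 0| + 1).
  apply: filterS H => h; rewrite distrC expr0 mulr1 => /ltW H.
  by rewrite -[g h](subrK (g 0)) (le_trans (ler_normD _ _))// addrC lerD2l.
apply: Oh_eq (OhM g0 (Oh_id R)) => h.
by rewrite -y00 gE subr0.
Qed.

(** One Picard step on lists: fields create round roots, matrices create square roots. *)
Definition next_list (ms : 'I_N -> seq (seq 'I_d * 'cV[R]_d))
    (l : seq (tw N * 'cV[R]_d)) : seq (tw N * 'cV[R]_d) :=
  flatten [seq grafts q (ms q) l ++ [seq (Square q t.1, L q *m t.2) | t <- l]
          | q <- enum 'I_N].

Lemma reduced_series_next ms l a h c :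
  reduced_series (next_list ms l) a h c = \sum_q (
    reduced_series (grafts q (ms q) l) a h c +
    \sum_e L q c e * series l (fun t => a (Square q t)) h e).
Proof.
rewrite /reduced_series big_flatten big_map big_enum /=; apply: eq_bigr => q _.
rewrite big_cat /=; congr (_ + _); rewrite big_map /=.
under [RHS]eq_bigr do rewrite mulr_sumr.
rewrite exchange_big /=; apply: eq_bigr => t _.
by rewrite mxE mulr_sumr; apply: eq_bigr => e _; ring.
Qed.

(* Only the existence of a common list of (tree, vector) pairs matters: the
   vectors absorb the elementary differentials and the Taylor coefficients. *)
Lemma solution_expansion n : exists l : seq (tw N * 'cV[R]_d),
  (forall q (i : 'I_(s q)),
     approx n.+1 l (fun t => theta t q i 0) (fun h => K h i)) /\
  approx n.+1 l (exact_weight R (N := N)) (fun h => y h - y0).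
Proof.
elim: n => [|n [l [HK Hy]]].
  exists [::]; split=> [q i|] c.
    by apply: Oh_eq (stages_Oh1 i c) => h; rewrite /series big_nil subr0.
  by apply: Oh_eq (solution_Oh1 c) => h; rewrite /series big_nil subr0 !mxE.
have H q := field_approx N y0 (@fsmooth q n.+1).
have [ms {}H] := choice H.
exists (next_list ms l); split=> [q i|] c.
  have HU : approx n.+1 l (stage_weight alpha gamma alpha i) (fun h => arg q i h).
    apply: (combination_approx (P := fun j => (j < i)%N) HK) => m j.
    by rewrite -leqNgt; exact: alpha0.
  have HV : approx n.+1 l (stage_weight alpha gamma gamma i) (fun h => lin q i h).
    apply: (combination_approx (P := fun j => (j <= i)%N) HK) => m j.
    by rewrite -ltnNge; exact: gamma0.
  have HL : Oh n.+1 (fun h => \sum_e L q c e *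
      (lin q i h e 0 - series l (stage_weight alpha gamma gamma i) h e)).
    by apply: Oh_sum => e _; apply: OhMl; exact: HV.
  (* The factor [h] of the stage equation raises the order from [n.+1] to [n.+2]. *)
  apply: Oh_near (OhM (Oh_id R) (OhD (H q l _ _ isT HU c) HL)).
  apply: filterS Kstages => h Kh; rewrite series_reduced.
  have -> : reduced_series (next_list ms l) (fun t => theta t q i 0) h c =
      \sum_(m <- ms q) (\prod_(j <- m.1)
        series l (stage_weight alpha gamma alpha i) h j) * m.2 c 0 +
      \sum_e L q c e * series l (stage_weight alpha gamma gamma i) h e.
    (* The common list has roots of every color, but [theta] at [q] vanishes on the others. *)
    rewrite reduced_series_next (bigD1 q)//= [X in _ + X = _]big1; last first.
      move=> q' q'q; rewrite reduced_series_grafts0.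
        rewrite add0r big1// => e _; rewrite /series big1 ?mulr0// => t _.
        by rewrite theta_Square (negbTE q'q) mulr0 mul0r.
      by move=> ch; rewrite theta_Round (negbTE q'q).
    rewrite addr0 (@reduced_series_grafts _ _ _ _ _ _ (stage_weight alpha gamma alpha i)).
      congr (_ + _); apply: eq_bigr => e _; congr (_ * _).
      by apply: eq_bigr => t _; rewrite theta_Square eqxx.
    by move=> ch; rewrite theta_Round eqxx.
  rewrite (Kh q i) !mxE -!mulrDr -mulrBr; congr (_ * _).
  under [X in _ + X = _]eq_bigr do rewrite mulrBr.
  by rewrite sumrB; ring.
have [y00 dy] := ysol.
(* [g'] is the derivative of the new remainder: it has order [n.+1], and integration gains one
   power. *)
pose g' h := \sum_q (f q (y0 + (y h - y0)) c 0 - \sum_(m <- ms q)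
  (\prod_(j <- m.1) series l (exact_weight R (N := N)) h j) * m.2 c 0).
apply: (Oh_primitive (g' := g')).
- apply: filterS dy => h dyh.
  have d1 := is_derive_coord c 0 dyh.
  have d2 := is_derive_series (next_list ms l) (exact_weight R (N := N)) c h.
  rewrite (_ : (fun _ => _) = (fun h => y h c 0) - cst (y0 c 0) -
    (fun h => series (next_list ms l) (exact_weight R (N := N)) h c)); last first.
    by apply/funext => x; rewrite !mxE.
  apply: is_derive_eq; rewrite subr0 summxE reduced_series_next -sumrB.
  apply: eq_bigr => q _; rewrite [y0 + _]addrC subrK; congr (_ - _).
  rewrite (@reduced_series_grafts _ _ _ _ _ _ (@exact_weight R N)); last first.
    exact: exact_weight_Round.
  rewrite [X in _ + X]big1 ?addr0// => e _; rewrite /series big1 ?mulr0// => t _.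
  by rewrite /exact_weight /= !mulr0 mul0r.
- by rewrite y00 subrr mxE series_reduced mul0r subr0.
- by apply: Oh_sum => q _; exact: H.
Qed.

Lemma order_conditions_sufficient (b : forall q : 'I_N, 'cV[R]_(s q)) p :
  (forall t, (rho t <= p)%N -> phi alpha gamma b t = exact_weight R t) ->
  (fun h : R => gark_row_output b y0 (K h) - y h)
    =O_ (0 : R) (fun h : R => h ^+ p.+1).
Proof.
move=> Hphi; apply: eqO_of_Oh => c.
have [l [HK Hy]] := solution_expansion p.
have H1 : Oh p.+1 (fun h => \sum_q \sum_i b q i 0 *
    (K h i c 0 - series l (fun t => theta t q i 0) h c)).
  by apply: Oh_sum => q _; apply: Oh_sum => i _; apply: OhMl; exact: HK.
have H2 : Oh p.+1 (fun h =>
    series l (fun t => phi alpha gamma b t - exact_weight R t) h c).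
  (* Trees with at most [p] vertices cancel by the order conditions; larger ones carry at least
     [h ^+ p.+1]. *)
  apply: Oh_sum => t _; have [tp|tp] := leqP (rho t.1) p.
    by apply: Oh_eq (Oh0 _ _) => h; rewrite Hphi// subrr mulr0 mul0r.
  by do 2 apply: OhMr; exact: Oh_pow.
(* The error is the stage remainder minus the solution remainder plus the difference of the two
   series. *)
apply: Oh_eq (OhD (OhB H1 (Hy c)) H2) => h.
have -> : series l (fun t => phi alpha gamma b t - exact_weight R t) h c =
    \sum_q \sum_i b q i 0 * series l (fun t => theta t q i 0) h c -
    series l (exact_weight R (N := N)) h c.
  rewrite /series; under [in RHS]eq_bigr do under eq_bigr do rewrite mulr_sumr.
  under [in RHS]eq_bigr do rewrite exchange_big.
  rewrite [in RHS]exchange_big /= -sumrB; apply: eq_bigr => t _.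
  rewrite phiE mulrBr mulrBl; congr (_ - _).
  rewrite mulr_sumr mulr_suml; apply: eq_bigr => q _.
  by rewrite mulr_sumr mulr_suml; apply: eq_bigr => i _; ring.
rewrite /gark_row_output !mxE summxE.
under eq_bigr do under eq_bigr do rewrite mulrBr.
under eq_bigr do rewrite sumrB.
rewrite sumrB.
have -> : \sum_q (\sum_i b q i ord0 *: K h i) c 0 =
    \sum_q \sum_i b q i 0 * K h i c 0.
  apply: eq_bigr => q _; rewrite summxE; apply: eq_bigr => i _; by rewrite mxE.
ring.
Qed.

End Sufficiency.

Theorem mainTheorem5 (R : realType) (N : nat) (s : 'I_N -> nat)
    (alpha gamma : forall q m : 'I_N, 'M[R]_(s q, s m))
    (b : forall q : 'I_N, 'cV[R]_(s q)) (p : nat) :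
  (forall (q m : 'I_N) (i : 'I_(s q)) (j : 'I_(s m)),
      (i <= j)%N -> alpha q m i j = 0) ->
  (forall (q m : 'I_N) (i : 'I_(s q)) (j : 'I_(s m)),
      (i < j)%N -> gamma q m i j = 0) ->
  gark_row_order alpha gamma b p <->
  (forall t : tw N, (1 <= rho t <= p)%N ->
     phi alpha gamma b t =
       (if only_round t then ((density t)%:R)^-1 else 0)).
Proof.
move=> a0 g0; split=> [ord t /andP[_ tp]|H].
  exact: order_conditions_necessary a0 g0 ord t tp.
move=> d f L y0 K y fs Ks ys.
apply: (order_conditions_sufficient a0 g0 fs Ks ys) => t tp.
by apply: H; rewrite rho_gt0.
Qed.
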